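(* Let $R$ be a $*$-ring and suppose $\Gamma^*_s(R)$ splits into two subgraphs $X$ and $Y$ via a vertex $a$. Then $\{0,a\}$ is an ideal of $R$.
   Context: A $*$-ring is a ring $R$ with an involution $x\mapsto x^*$ (an additive anti-automorphism of period at most two). For $S\subseteq R$, $r_R(S)=\{x\in R: sx=0\ \forall s\in S\}$. The strong zero-divisor graph $\Gamma^*_s(R)$ is the simple undirected graph with vertex set $\{0\neq a\in R: r_R(aR)\neq\{0\}\}$, in which distinct vertices $a,b$ are adjacent iff $aRb^*=0$. A graph $G$ splits into subgraphs $X$ and $Y$ via $a$ if (i) $|V(X)|\ge 2$ and $|V(Y)|\ge 2$, (ii) $X\cup Y=G$, (iii) $V(X)\cap V(Y)=\{a\}$, (iv) $a$ is a cut vertex of $G$ (its removal increases the number of connected components), and (v) no $x\in V(X)\setminus\{a\}$ is adjacent to any $y\in V(Y)\setminus\{a\}$. *)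

(* Defs.v *)
From HB Require Import structures.
From Stdlib Require Import Relation_Operators.
From mathcomp Require Import all_boot all_order all_algebra.
From mathcomp Require Import all_classical.

Set Implicit Arguments.
Unset Strict Implicit.
Unset Printing Implicit Defensive.

Import GRing.Theory.
Local Open Scope classical_set_scope.
Local Open Scope card_scope.
Local Open Scope ring_scope.

(* Associative rings, with no identity element assumed; the library's
   pzRingType always has a 1. *)
HB.mixin Record Zmodule_isRng R of GRing.Zmodule R := {
  rng_mul : R -> R -> R;
  rng_mulA : associative rng_mul;
  rng_mulDl : left_distributive rng_mul +%R;
  rng_mulDr : right_distributive rng_mul +%R
}.

#[short(type="rngType")]
HB.structure Definition Rng := {R of GRing.Zmodule R & Zmodule_isRng R}.

Declare Scope rng_scope.
Delimit Scope rng_scope with rng.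
Notation "x * y" := (rng_mul x y) : rng_scope.
Local Open Scope rng_scope.

HB.mixin Record Rng_hasStar R of Rng R := {
  star : R -> R;
  starD : {morph star : x y / x + y};
  starM : forall x y : R, star (x * y) = star y * star x;
  starK : involutive star
}.

#[short(type="starRingType")]
HB.structure Definition StarRing := {R of Rng R & Rng_hasStar R}.

Section RngTheory.
Variable R : rngType.
Implicit Types (x y a : R) (S I : set R).

Definition rann S : set R := [set x | forall s, S s -> s * x = 0].

Definition rmulset a : set R := [set a * x | x in [set: R]].

(* Two-sided ideals. *)
Definition is_ideal I : Prop :=
  [/\ I 0,
      forall x y, I x -> I y -> I (x - y),
      forall r x, I x -> I (r * x) &
      forall r x, I x -> I (x * r)].

Lemma rng_mul0r x : 0 * x = 0.
Proof. by apply: (addrI (0 * x)); rewrite -rng_mulDl !addr0. Qed.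

Lemma rng_mulr0 x : x * 0 = 0.
Proof. by apply: (addrI (x * 0)); rewrite -rng_mulDr !addr0. Qed.

End RngTheory.

Lemma star0 (R : starRingType) : star (0 : R) = 0.
Proof. by apply: (addrI (star (0 : R))); rewrite -starD !addr0. Qed.

(* A simple undirected graph whose vertices form a (possibly infinite) subset
   of T. *)
Record sgraph (T : Type) := SGraph {
  vset : set T;
  edge : T -> T -> Prop;
  edge_vset : forall x y, edge x y -> vset x;
  edge_sym : forall x y, edge x y -> edge y x;
  edge_irrefl : forall x, ~ edge x x
}.

Section Graphs.
Variable T : Type.
Implicit Types (G X Y : sgraph T) (a x y : T).

Definition subgraph X G : Prop :=
  vset X `<=` vset G /\ forall x y, edge X x y -> edge G x y.

Definition is_union X Y G : Prop :=
  vset X `|` vset Y = vset G /\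
  forall x y, edge G x y <-> edge X x y \/ edge Y x y.

Definition reachable G : T -> T -> Prop := clos_refl_trans T (edge G).

Definition component G x : set T := [set y | vset G y /\ reachable G x y].

Definition components G : set (set T) := [set component G x | x in vset G].

Section DelVertex.
Variables (G : sgraph T) (a : T).

Definition del_edge x y : Prop := [/\ edge G x y, x <> a & y <> a].

Lemma del_edge_vset x y : del_edge x y -> (vset G `\ a) x.
Proof. by case=> Gxy xa _; split=> //; exact: edge_vset Gxy. Qed.

Lemma del_edge_sym x y : del_edge x y -> del_edge y x.
Proof. by case=> Gxy xa ya; split=> //; exact: edge_sym. Qed.

Lemma del_edge_irrefl x : ~ del_edge x x.
Proof. by case=> Gxx _ _; exact: edge_irrefl Gxx. Qed.

Definition del_vertex : sgraph T :=
  SGraph del_edge_vset del_edge_sym del_edge_irrefl.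

End DelVertex.

(* "Increases the number of components" is a strict inequality of cardinals. *)
Definition cut_vertex G a : Prop :=
  [/\ vset G a,
      components G #<= components (del_vertex G a) &
      ~ (components (del_vertex G a) #<= components G)].

Record splits_via G X Y a : Prop := SplitsVia {
  splits_card_l : `I_2 #<= vset X;
  splits_card_r : `I_2 #<= vset Y;
  splits_union : is_union X Y G;
  splits_inter : vset X `&` vset Y = [set a];
  splits_cut : cut_vertex G a;
  splits_nonadj : forall x y,
    (vset X `\ a) x -> (vset Y `\ a) y -> ~ edge G x y
}.

End Graphs.

Section StrongZeroDivisorGraph.
Variable R : starRingType.
Implicit Types a b x : R.

Definition szd_vset : set R :=
  [set a | a <> 0 /\ rann (rmulset a) <> [set 0]].

Definition szd_edge a b : Prop :=
  [/\ szd_vset a, szd_vset b, a <> b & forall r : R, a * r * star b = 0].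

Lemma szd_edge_vset a b : szd_edge a b -> szd_vset a.
Proof. by case. Qed.

Lemma szd_edge_sym a b : szd_edge a b -> szd_edge b a.
Proof.
move=> [Va Vb ab abE]; split=> // [/esym //|r].
by rewrite -[RHS](star0 R) -(abE (star r)) !starM !starK rng_mulA.
Qed.

Lemma szd_edge_irrefl a : ~ szd_edge a a.
Proof. by case. Qed.

Definition strong_zdg : sgraph R :=
  SGraph szd_edge_vset szd_edge_sym szd_edge_irrefl.

End StrongZeroDivisorGraph.

(* Main.v *)
Require Import Defs.
From Stdlib Require Import Relation_Operators Operators_Properties.
From mathcomp Require Import all_boot all_order all_algebra.
From mathcomp Require Import all_classical.
Import GRing.Theory.
Local Open Scope classical_set_scope.
Local Open Scope ring_scope.

(** Since [a] is a cut vertex, it has two neighbours [x] and [y] that are not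
    connected in the graph without [a].  The set of all [b] with [bRx^* = 0]
    and [bRy^* = 0] is a two-sided ideal containing [a].  It contains no other
    nonzero element: such a [b] would be a vertex different from [a] that either
    is one of [x], [y] and adjacent to the other, or is adjacent to both. *)

Section CutVertex.
Local Open Scope card_scope.
Context {T : Type} {G : sgraph T} {a : T}.

(** Each passage of a walk through [a] enters and leaves by neighbours of [a], so a detour between
    these two neighbours can replace it. *)
Lemma reachable_del_vertex :
  (forall x y, edge G a x -> edge G a y -> reachable (del_vertex G a) x y) ->
  forall x y, x <> a -> y <> a ->
    reachable G x y -> reachable (del_vertex G a) x y.
Proof.
move=> nbr x y xa ya /(clos_rt_rtn1 T (edge G)) xy.
(* The induction must also cover prefixes that end at [a]: for these it remembers a neighbour [w] of
   [a] already reached without [a], from which the next detour starts. *)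
suff [ly _] : (y <> a -> reachable (del_vertex G a) x y) /\
  (y = a -> exists2 w, edge G a w & reachable (del_vertex G a) x w).
  exact: ly.
elim: xy => {y ya} [|y z yz _ [IHn IHa]]; first by split=> // _; exact: rt_refl.
split=> [za|za].
- have [ya|ya] := pselect (y = a).
    have [w aw xw] := IHa ya; apply: rt_trans xw _.
    by apply: nbr => //; rewrite -ya.
  by apply: rt_trans (IHn ya) _; apply: rt_step.
- rewrite {}za in yz; have [ya|ya] := pselect (y = a).
    by rewrite ya in yz; case: (edge_irrefl yz).
  by exists y; [exact: edge_sym|exact: IHn].
Qed.

Lemma reachable_of_del_vertex x y :
  reachable (del_vertex G a) x y -> reachable G x y.
Proof.
elim=> [u v []|u|u v w _ uv _ vw]; [by move=> *; exact: rt_step|exact: rt_refl|].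
exact: rt_trans uv vw.
Qed.

Lemma cut_vertex_neighbours : cut_vertex G a ->
  exists x y, [/\ edge G a x, edge G a y & ~ reachable (del_vertex G a) x y].
Proof.
case=> _ _; apply: contra_notP => noxy.
have nbr x y : edge G a x -> edge G a y -> reachable (del_vertex G a) x y.
  by move=> ax ay; apply: contrapT => nxy; apply: noxy; exists x, y.
(* If deleting [a] separates no two of its neighbours, each remaining component is an old one minus
   [a], so their number cannot grow. Equality may fail: an isolated [a] yields the empty set. *)
have sub : components (del_vertex G a) `<=`
    (fun C : set T => C `\ a) @` components G.
  move=> _ [x [Gx xa] <-]; exists (component G x); first by exists x.
  apply/seteqP; split=> [y [[Gy xy] ya]|y [[Gy ya] xy]]; split=> //.
    exact: reachable_del_vertex.
  by split=> //; exact: reachable_of_del_vertex.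
exact: card_le_trans (subset_card_le sub) (card_image_le _ _).
Qed.

End CutVertex.

Section LeftAnnihilator.
Local Open Scope rng_scope.

(** The left annihilator of [Rc]. For [c = star x] it contains all neighbours of [x]. *)
Definition lannR {R : rngType} (c : R) : set R :=
  [set b | forall r, b * r * c = 0].

Lemma lannR_ideal {R : rngType} (c : R) : is_ideal (lannR c).
Proof.
split=> [r|x y xc yc r|s x xc r|s x xc r] /=.
- by rewrite !rng_mul0r.
- apply: (addIr (y * r * c)).
  by rewrite -!rng_mulDl subrK yc addr0.
- by rewrite -2!rng_mulA [x * _]rng_mulA xc rng_mulr0.
- by rewrite -[x * s * r]rng_mulA.
Qed.

(** The element [c] is itself a nonzero right annihilator of [bR]. *)
Lemma szd_vset_lannR {R : starRingType} (b c : R) :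
  b <> 0 -> c <> 0 -> lannR c b -> szd_vset b.
Proof.
move=> b0 c0 bc; split=> // E; apply: c0.
have : rann (rmulset b) c by move=> _ [r _ <-]; exact: bc.
by rewrite E.
Qed.

Lemma star_neq0 {R : starRingType} (x : R) : x <> 0 -> star x <> 0.
Proof. by move=> x0 sx0; apply: x0; rewrite -(starK x) sx0 star0. Qed.

End LeftAnnihilator.

Lemma is_idealI {R : rngType} (I J : set R) :
  is_ideal I -> is_ideal J -> is_ideal (I `&` J).
Proof.
move=> [I0 IB Il Ir] [J0 JB Jl Jr]; split.
- by [].
- by move=> x y [Ix Jx] [Iy Jy]; split; [exact: IB|exact: JB].
- by move=> r x [Ix Jx]; split; [exact: Il|exact: Jl].
- by move=> r x [Ix Jx]; split; [exact: Ir|exact: Jr].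
Qed.

Lemma cut_vertex_ideal {R : starRingType} {a : R} :
  cut_vertex (strong_zdg R) a -> is_ideal [set 0; a].
Proof.
move=> cut; have [x [y [ax ay nxy]]] := cut_vertex_neighbours cut.
have [Va Vx a_x aRx] := ax; have [_ Vy a_y aRy] := ay.
have nexy : x <> y by move=> xy; apply: nxy; rewrite xy; exact: rt_refl.
(* Both ends differ from [a], so such an edge would survive its deletion. *)
have edge_nxy : ~ szd_edge x y.
  by move=> xy; apply: nxy; apply: rt_step; split=> //; exact/nesym.
have idI : is_ideal (lannR (star x) `&` lannR (star y)).
  by apply: is_idealI; exact: lannR_ideal.
suff -> : [set 0; a] = lannR (star x) `&` lannR (star y) by [].
apply/seteqP; split=> [b [->|->]|b [bx by_]]; first by case: idI.
  by split.
apply: contrapT => nb.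
have b0 : b <> 0 by move=> b0; apply: nb; left.
have ba : b <> a by move=> ba; apply: nb; right.
have Vb : szd_vset b.
  by apply: (szd_vset_lannR b (star x)) => //; apply: star_neq0; case: Vx.
have [bEx|bnx] := pselect (b = x).
  by apply: edge_nxy; rewrite -bEx in Vx nexy *; split.
have [bEy|bny] := pselect (b = y).
  apply/edge_nxy/szd_edge_sym.
  by rewrite -bEy in Vy nexy *; split=> //; exact/nesym.
have bxE : szd_edge b x by split.
have byE : szd_edge b y by split.
(* The path [x], [b], [y] avoids [a]. *)
apply: nxy; apply: (@rt_trans _ _ _ b); apply: rt_step; split=> //.
- exact: szd_edge_sym.
- exact/nesym.
- exact/nesym.
Qed.

Theorem theorem2p7 (R : starRingType) (X Y : sgraph R) (a : R)
    (hX : subgraph X (strong_zdg R)) (hY : subgraph Y (strong_zdg R))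
    (hsplit : splits_via (strong_zdg R) X Y a) :
  is_ideal [set 0; a].
Proof. exact: cut_vertex_ideal (splits_cut hsplit). Qed.
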